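(* Let $F$ be a field of characteristic $2$ and let $Q$ be a quaternion algebra over $F$. (i) If $a_1,a_2\in F$ and $b_1,b_2\in F^\times$ satisfy $[Q]=[a_1,b_1)=[a_2,b_2)$, then there is $b\in F^\times$ such that $[Q]=[a_1,b)=[a_2,b)$. (ii) If $a_1,a_2\in F$ and $b_1,b_2\in F^\times$ satisfy $[Q]=[a_1,b_1)=[a_2,b_2)$, then there is $a\in F$ such that $[Q]=[a,b_1)=[a,b_2)$. (iii) If $a_1,a_2,b_1,b_2\in F$ satisfy $[Q]=((a_1,b_1))=((a_2,b_2))$, then there is $a\in F$ such that $[Q]=((a,b_1))=((a,b_2))$.
   Context: For a field $F$, $F^\times=F\setminus\{0\}$. A quaternion algebra over $F$ is a central simple $F$-algebra of dimension $4$ (possibly split, i.e. isomorphic to $M_2(F)$). For a central simple $F$-algebra $A$, $[A]$ denotes its class in the Brauer group $\mathrm{Br}(F)$, written additively, so $[A]+[B]=[A\otimes_F B]$ and $[M_n(F)]=0$. Let $\operatorname{char} F=2$. The symbol $[a,b)$: for $a\in F$ and $b\in F^\times$, $[a,b):=[Q_{[a,b)}]\in \mathrm{Br}(F)$, where $Q_{[a,b)}$ is the quaternion algebra with $F$-basis $1,i,j,ij$ and relations $i^2+i=a$, $j^2=b$, $ij+ji=j$. The symbol $((a,b))$: for $a,b\in F$ (zero allowed), $((a,b)):=[Q_{((a,b))}]\in \mathrm{Br}(F)$, where $Q_{((a,b))}$ is the quaternion algebra with $F$-basis $1,i,j,ij$ and relations $i^2=a$, $j^2=b$, $ij+ji=1$.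 *)

(* Defs.v *)
From HB Require Import structures.
From mathcomp Require Import all_boot all_order all_algebra all_field.
From mathcomp Require Import ring.

Set Implicit Arguments.
Unset Strict Implicit.
Unset Printing Implicit Defensive.

Import GRing.Theory.
Local Open Scope ring_scope.

Section CentralSimple.
Variable F : fieldType.

(* Every two-sided ideal of a unital F-algebra is an F-subspace. *)
Definition simple_alg (A : falgType F) : Prop :=
  forall I : {vspace A},
    ({:A} * I <= I)%VS -> (I * {:A} <= I)%VS -> I = 0%VS \/ I = {:A}%VS.

Definition central_alg (A : falgType F) : Prop := 'Z({:A})%VS = 1%VS.

Definition central_simple (A : falgType F) : Prop :=
  central_alg A /\ simple_alg A.

Definition quaternion_algebra (A : falgType F) : Prop :=
  central_simple A /\ \dim {:A} = 4%N.

(* [A] = [B] in Br(F): M_m(A) and M_n(B) are isomorphic as F-algebras for some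
   m, n >= 1.  A scalar c in F acts on 'M[A]_m through c%:A in A. *)
Definition brauer_eq (A B : falgType F) : Prop :=
  exists m n : nat, exists f : {rmorphism 'M[A]_m.+1 -> 'M[B]_n.+1},
    bijective f /\ forall (c : F) (M : 'M[A]_m.+1), f (c%:A *: M) = c%:A *: f M.

End CentralSimple.

(* The F-algebra with basis 1, i, j, ij (coordinates 0, 1, 2, 3) and relations
     i^2 = u i + a,   j^2 = b,   ij + ji = u j + w.
   It is associative for all parameters, in every characteristic. *)
Definition quat (F : fieldType) (u w a b : F) : Type := 'rV[F]_4.

Section QuatAlgebra.
Variables (F : fieldType) (u w a b : F).
Local Notation H := (quat u w a b).

HB.instance Definition _ := Vector.copy H 'rV[F]_4.

Definition mkquat (x0 x1 x2 x3 : F) : H :=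
  \row_(n < 4) [:: x0; x1; x2; x3]`_n.

Definition qc (x : H) (n : nat) : F := (x : 'rV[F]_4) ord0 (inord n).

Definition qone : H := mkquat 1 0 0 0.

Definition qmul (x y : H) : H :=
  let x0 := qc x 0 in let x1 := qc x 1 in let x2 := qc x 2 in
  let x3 := qc x 3 in
  let y0 := qc y 0 in let y1 := qc y 1 in let y2 := qc y 2 in
  let y3 := qc y 3 in
  mkquat
    (x0 * y0 + a * x1 * y1 + w * x2 * y1 + b * x2 * y2 + u * b * x2 * y3
       - a * b * x3 * y3)
    (x0 * y1 + x1 * y0 + u * x1 * y1 - b * x2 * y3 + w * x3 * y1 + b * x3 * y2)
    (x0 * y2 + x2 * y0 + a * x1 * y3 + u * x2 * y1 + w * x2 * y3 - a * x3 * y1)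
    (x0 * y3 + x3 * y0 + x1 * y2 + u * x1 * y3 - x2 * y1 + w * x3 * y3).

Lemma qcE x0 x1 x2 x3 :
  (qc (mkquat x0 x1 x2 x3) 0 = x0) * (qc (mkquat x0 x1 x2 x3) 1 = x1)
  * (qc (mkquat x0 x1 x2 x3) 2 = x2) * (qc (mkquat x0 x1 x2 x3) 3 = x3).
Proof. by rewrite /qc !mxE !inordK. Qed.

Lemma qcD (x y : H) n : qc (x + y) n = qc x n + qc y n.
Proof. by rewrite /qc mxE. Qed.

Lemma qcZ c (x : H) n : qc (c *: x) n = c * qc x n.
Proof. by rewrite /qc mxE. Qed.

Lemma qcN (x : H) n : qc (- x) n = - qc x n.
Proof. by rewrite /qc mxE. Qed.

Lemma qc0 n : qc (0 : H) n = 0.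
Proof. by rewrite /qc mxE. Qed.

Lemma quat_eqP (x y : H) :
  qc x 0 = qc y 0 -> qc x 1 = qc y 1 -> qc x 2 = qc y 2 -> qc x 3 = qc y 3 ->
  x = y.
Proof.
move=> e0 e1 e2 e3; apply/rowP => n; rewrite -(inord_val n).
by case: n => [[|[|[|[|n]]]] //= _].
Qed.

Let mulA : associative qmul.
Proof. by move=> x y z; apply: quat_eqP; rewrite !qcE; ring. Qed.

Let mul1 : left_id qone qmul.
Proof. by move=> x; apply: quat_eqP; rewrite !qcE; ring. Qed.

Let mulq1 : right_id qone qmul.
Proof. by move=> x; apply: quat_eqP; rewrite !qcE; ring. Qed.

Let mulDl : left_distributive qmul +%R.
Proof. by move=> x y z; apply: quat_eqP; rewrite !(qcE, qcD); ring. Qed.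

Let mulDr : right_distributive qmul +%R.
Proof. by move=> x y z; apply: quat_eqP; rewrite !(qcE, qcD); ring. Qed.

Let one_neq0 : qone != 0.
Proof.
apply/eqP => /(congr1 (fun x => qc x 0)); rewrite qcE qc0.
by move/eqP; rewrite oner_eq0.
Qed.

HB.instance Definition _ :=
  GRing.Zmodule_isNzRing.Build H mulA mul1 mulq1 mulDl mulDr one_neq0.

Let scaleAl c (x y : H) : c *: (x * y) = (c *: x) * y.
Proof. by apply: quat_eqP; rewrite !(qcE, qcZ); ring. Qed.

HB.instance Definition _ := GRing.Lmodule_isLalgebra.Build F H scaleAl.

Let scaleAr c (x y : H) : c *: (x * y) = x * (c *: y).
Proof. by apply: quat_eqP; rewrite !(qcE, qcZ); ring. Qed.

HB.instance Definition _ := GRing.Lalgebra_isAlgebra.Build F H scaleAr.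
HB.instance Definition _ := Algebra_isFalgebra.Build F H.

Definition qi : H := mkquat 0 1 0 0.
Definition qj : H := mkquat 0 0 1 0.

Lemma qc1 : (qc (1 : H) 0 = 1) * (qc (1 : H) 1 = 0)
  * (qc (1 : H) 2 = 0) * (qc (1 : H) 3 = 0).
Proof. by rewrite -[1]/qone !qcE. Qed.

Lemma qcM (x y : H) n : qc (x * y) n = qc (qmul x y) n.
Proof. by []. Qed.

Definition qcalc := (qc1, qcM, qcE, qcD, qcZ, qcN, qc0).

Lemma quat_dim : \dim {:H} = 4%N.
Proof. by rewrite dimvf /dim /= mul1n. Qed.

Lemma quat_coord (x : H) :
  x = (qc x 0)%:A + qc x 1 *: qi + qc x 2 *: qj + qc x 3 *: (qi * qj).
Proof. by apply: quat_eqP; rewrite !qcalc; ring. Qed.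

Lemma quat_basis : basis_of {:H} [:: 1; qi; qj; qi * qj].
Proof.
rewrite basisEdim quat_dim /= andbT; apply/subvP => x _.
rewrite (quat_coord x).
by rewrite !rpredD ?rpredZ // memv_span // !inE eqxx ?orbT.
Qed.

Lemma quat_ii : qi ^+ 2 = u *: qi + a%:A.
Proof. by apply: quat_eqP; rewrite expr2 !qcalc; ring. Qed.

Lemma quat_jj : qj ^+ 2 = b%:A.
Proof. by apply: quat_eqP; rewrite expr2 !qcalc; ring. Qed.

Lemma quat_ij_ji : qi * qj + qj * qi = u *: qj + w%:A.
Proof. by apply: quat_eqP; rewrite !qcalc; ring. Qed.

Hypothesis ch2 : 2%N \in [pchar F].

Let dbl (x : H) : x + x = 0.
Proof. by rewrite -mulr2n -scaler_nat (pcharf0 ch2) scale0r. Qed.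

Let e : H := u *: qj + w%:A.
Let e' : H := w%:A - u *: qj.
Let d := w ^+ 2 - u ^+ 2 * b.

Let ee' (x : H) : x * e * e' = d *: x.
Proof. by rewrite -mulrA; apply: quat_eqP; rewrite !qcalc /d; ring. Qed.

Let commj (x : H) :
  qj * x - x * qj = ((qc x 1)%:A + qc x 3 *: qj) * e.
Proof.
pose y := qc x 1 *: (qi * qj) + (b * qc x 3) *: qi.
rewrite -[LHS]addr0 -(dbl y); apply: quat_eqP; rewrite !qcalc; ring.
Qed.

Let commi (p q : F) (x : H := p%:A + q *: qj) : qi * x - x * qi = (- q)%:A * e.
Proof.
pose y := - q *: (qi * qj).
rewrite -[LHS]addr0 -(dbl y); apply: quat_eqP; rewrite !qcalc; ring.
Qed.

Let comm_ideal (I : {vspace H}) (x : H) : d != 0 ->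
    ({:H} * I <= I)%VS -> (I * {:H} <= I)%VS ->
    qi * x - x * qi \in I -> qj * x - x * qj \in I ->
  1 \in I \/ x = (qc x 0)%:A.
Proof.
move=> d0 /prodvP Il /prodvP Ir Ii Ij.
have Ie (y : H) : y * e \in I -> y \in I.
  move=> /Ir /(_ (memvf e')); rewrite ee' => /(rpredZ d^-1).
  by rewrite scalerA mulVf // scale1r.
have I1 (c : F) : c%:A \in I -> c = 0 \/ 1 \in I.
  case: (eqVneq c 0) => [->|c0]; first by left.
  by move=> /(rpredZ c^-1); rewrite scalerA mulVf // scale1r; right.
rewrite commj in Ij; move/Ie: Ij => Ij.
have : (- qc x 3)%:A * e \in I.
  rewrite -(commi (qc x 1)).
  by apply: rpredB; [exact: Il (memvf _) Ij | exact: Ir Ij (memvf _)].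
case/Ie/I1 => [/eqP|]; last by left.
rewrite oppr_eq0 => /eqP x3; move: Ij; rewrite x3 scale0r addr0.
case/I1 => [x1|]; last by left.
have xE : x = (qc x 0)%:A + qc x 2 *: qj.
  by rewrite {1}(quat_coord x) x1 x3 !scale0r !addr0.
move: Ii; rewrite xE commi => /Ie /I1 [/eqP|]; last by left.
rewrite oppr_eq0 => /eqP x2; right.
by rewrite {1}xE x2 scale0r addr0.
Qed.

Lemma quat_quaternion : w ^+ 2 - u ^+ 2 * b != 0 -> quaternion_algebra H.
Proof.
move=> d0; split; last exact: quat_dim.
split.
  apply/eqP; rewrite eqEsubv; apply/andP; split; last first.
    apply/subvP => _ /vlineP[c ->]; rewrite memv_cap memvf /=.
    by apply/centvP => y _; rewrite -scalerAl -scalerAr mul1r mulr1.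
  apply/subvP => x; rewrite memv_cap => /andP[_ /centvP cx].
  have [|||||->] := @comm_ideal 0%VS x d0; last exact/memvZ/memv_line.
  - by rewrite prodv0.
  - by rewrite prod0v.
  - by rewrite memv0 (cx qi) ?memvf // subrr.
  - by rewrite memv0 (cx qj) ?memvf // subrr.
  - by rewrite memv0 oner_eq0.
move=> I Il Ir.
have [->|I0] := eqVneq I 0%VS; [by left | right].
suff I1 : 1 \in I.
  apply/eqP; rewrite eqEsubv subvf; apply/subvP => x _.
  by rewrite -[x]mulr1; move/prodvP: Il; apply; rewrite ?memvf.
have Ix := memv_pick I; move: (vpick I) Ix (vpick0 I) => x Ix.
rewrite (negbTE I0) => /negbT x0.
have [//||//|xE] := comm_ideal d0 Il Ir (x := x).
- by rewrite rpredB //; [move/prodvP: Il | move/prodvP: Ir];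
    apply; rewrite ?memvf.
- by rewrite rpredB //; [move/prodvP: Il | move/prodvP: Ir];
    apply; rewrite ?memvf.
rewrite xE in Ix x0; move: Ix => /(rpredZ (qc x 0)^-1).
rewrite scalerA mulVf ?scale1r //.
by apply: contraNneq x0 => ->; rewrite scale0r.
Qed.

End QuatAlgebra.

(* The algebras whose classes are [a, b) and ((a, b)) in characteristic 2. *)
Definition quat_as (F : fieldType) (a b : F) : falgType F := quat 1 0 a b.
Definition quat_bi (F : fieldType) (a b : F) : falgType F := quat 0 1 a b.

Section Char2.
Variables (F : fieldType) (ch2 : 2%N \in [pchar F]).

Lemma quat_as_rel (a b : F) (i : quat_as a b := qi 1 0 a b)
    (j : quat_as a b := qj 1 0 a b) :
  [/\ basis_of {:quat_as a b} [:: 1; i; j; i * j],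
      i ^+ 2 + i = a%:A, j ^+ 2 = b%:A & i * j + j * i = j].
Proof.
split; [exact: quat_basis | | exact: quat_jj |].
  rewrite quat_ii scale1r addrAC -mulr2n -scaler_nat.
  by rewrite (pcharf0 ch2) scale0r add0r.
by rewrite quat_ij_ji scale1r scale0r addr0.
Qed.

Lemma quat_as_quaternion (a b : F) :
  b != 0 -> quaternion_algebra (quat_as a b).
Proof.
move=> b0; apply: quat_quaternion => //.
by rewrite expr0n expr1n mul1r sub0r oppr_eq0.
Qed.

Lemma quat_bi_rel (a b : F) (i : quat_bi a b := qi 0 1 a b)
    (j : quat_bi a b := qj 0 1 a b) :
  [/\ basis_of {:quat_bi a b} [:: 1; i; j; i * j],
      i ^+ 2 = a%:A, j ^+ 2 = b%:A & i * j + j * i = 1].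
Proof.
split; [exact: quat_basis | | exact: quat_jj |].
  by rewrite quat_ii scale0r add0r.
by rewrite quat_ij_ji scale0r add0r scale1r.
Qed.

Lemma quat_bi_quaternion (a b : F) : quaternion_algebra (quat_bi a b).
Proof.
apply: quat_quaternion => //.
by rewrite expr0n expr1n mul0r subr0 oner_eq0.
Qed.

End Char2.

(* Main.v *)
From HB Require Import structures.
Require Import Defs.
From mathcomp Require Import all_boot all_order all_algebra all_field.
From mathcomp Require Import ring.

(** The proof has two halves: Brauer equivalence is first turned into a
statement about elements of Q, and the elements are then found by linear
algebra over F.

From classes to elements. For quaternion algebras, equality of Brauer classes
means isomorphism. If M_m(Q) and M_n(A) are isomorphic and Q, A have the same
dimension, then m = n, and the matrix unit E_00 of M_n(A) goes to an idempotent
e of M_n(Q) generating a right ideal of the same dimension as that of the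
matrix unit E_00 of M_n(Q). In a simple finite-dimensional algebra two
idempotents generating right ideals of equal dimension are equivalent, that is,
of the forms u v and v u ([equiv_idem_dim]); conjugating by u and v carries the
corner A = e M_n(Q) e to the corner Q ([brauer_eq_hom]). Hence
[Q] = [a,b) if and only if Q contains i, j with i^2 + i = a, j^2 = b and
ij + ji = j (when b <> 0), and likewise for ((a,b)) ([brauer_eq_quatP]).

Finding the elements. Write T and N for the reduced trace and norm of Q and B
for the polar form of N. For a given i with T(i) = 1, one has ij + ji = j if
and only if j is orthogonal to 1 and i; moreover j^2 = N(j) for such a j.

(i) The orthogonal complement of 1, i1, i2 in the 4-dimensional space Q
contains some j <> 0; it anticommutes in the above sense with both i1 and i2,
and b = N(j) serves both symbols when it is nonzero. If N(j) = 0, the planes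
orthogonal to F(i1) and to F(i2) are both isotropic, hence hyperbolic, hence
both represent 1, so that b = 1 works ([as_common_slot_right]).

(ii) One wants i with T(i) = 1 orthogonal to both j1 and j2. This linear system
is solvable unless 1, j1, j2 are linearly dependent. In that case
F(j1) = F(j2), and one looks instead for two elements i, i' of trace 1, i
orthogonal to j1 and i' orthogonal to j2, with the same norm
([as_common_slot_left]).

(iii) The same argument, with T(i) = 0 and B(i, j1) = B(i', j2) = 1
([bi_common_slot]).

The computations are carried out in the coordinates of the basis 1, i1, j1,
i1 j1, where the reduced trace of x is u x_1 + w x_3. *)

Set Implicit Arguments.
Unset Strict Implicit.
Unset Printing Implicit Defensive.

Import GRing.Theory.
Local Open Scope ring_scope.

(** * Idempotents of a prime finite-dimensional algebra *)

(** The part of simplicity that controls idempotents; it passes to matrix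
algebras entry by entry. *)
Definition prime_alg (F : fieldType) (B : falgType F) :=
  forall x y : B, (forall b, x * b * y = 0) -> x = 0 \/ y = 0.

(** Murray-von Neumann equivalence of idempotents; u and v are inverse
isomorphisms between the right ideals generated by f and by e. *)
Definition equiv_idem (R : nzRingType) (e f : R) :=
  exists u v : R, [/\ u * v = e, v * u = f, e * u = u & v * e = v].

Section PrimeAlgebra.
Variables (F : fieldType) (B : falgType F).
Implicit Types (x y e f u v : B) (J : {vspace B}).

Notation rideal x := (amull x @: fullv)%VS.

Lemma mem_rideal x b : x * b \in rideal x.
Proof. by have /= := memv_img (amull x) (memvf b); rewrite lfunE. Qed.

Lemma ridealP x y : reflect (exists b, y = x * b) (y \in rideal x).
Proof.
apply: (iffP memv_imgP) => [[b _ ->]|[b ->]]; exists b; rewrite ?memvf //;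
  by rewrite lfunE.
Qed.

Lemma sub_rideal x y : x \in rideal y -> (rideal x <= rideal y)%VS.
Proof.
case/ridealP=> b ->; apply/subvP=> _ /ridealP[c ->].
by rewrite -mulrA mem_rideal.
Qed.

Lemma proper_rideal x y z :
  (rideal x <= rideal y)%VS -> z \in rideal y -> z \notin rideal x ->
  (\dim (rideal x) < \dim (rideal y))%N.
Proof.
move=> sxy zy zx; rewrite ltn_neqAle dimvS // andbT.
apply: contra zx => dxy; suff -> : rideal x = rideal y by [].
by apply/eqP; rewrite -dimv_leqif_eq.
Qed.

Lemma dim_rideal_mull x y : (\dim (rideal (x * y)) <= \dim (rideal y))%N.
Proof.
have -> : rideal (x * y) = (amull x @: rideal y)%VS.
  by rewrite amullM limg_comp.
by rewrite -(limg_ker_dim (amull x) (rideal y)) leq_addl.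
Qed.

Lemma dim_rideal_mulr x y : (\dim (rideal (x * y)) <= \dim (rideal x))%N.
Proof. by rewrite dimvS // sub_rideal // mem_rideal. Qed.

Lemma idem_eq e f : e * e = e -> f * e = e -> e * f = e ->
  \dim (rideal f) = \dim (rideal e) -> e = f.
Proof.
move=> ee fe ef dfe.
have /eqP E : rideal e == rideal f.
  rewrite -dimv_leqif_eq ?dfe // sub_rideal //.
  by apply/ridealP; exists e.
have : f \in rideal e by rewrite E; apply/ridealP; exists 1; rewrite mulr1.
by case/ridealP=> b fb; rewrite -ef fb mulrA ee.
Qed.

Hypothesis primeB : prime_alg B.

Lemma prime_neq0 x y : x != 0 -> y != 0 -> exists b, x * b * y != 0.
Proof.
move=> x0 y0; pose W := (amulr y @: (amull x @: fullv))%VS.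
have [W0|/eqP W0] := eqVneq W 0%VS.
  have [b|/eqP|/eqP] := @primeB x y; rewrite ?(negPf x0) ?(negPf y0) //.
  apply/eqP; rewrite -memv0 -W0.
  have := memv_img (amulr y) (memv_img (amull x) (memvf b)).
  by rewrite !lfunE.
move/eqP: W0; rewrite -vpick0; have := memv_pick W.
case/memv_imgP=> _ /memv_imgP[b _ ->] ->; rewrite !lfunE /= => H.
by exists b.
Qed.

(** Brauer's lemma. As the algebra is prime, some a in J has a J <> 0. If a J is
smaller than J, it contains an idempotent by induction. If a J = J, left
multiplication by a is injective on J; the solution e in J of a e = a then has
a (e e - e) = 0, so it is idempotent. *)
Lemma ex_idem J : (forall x b, x \in J -> x * b \in J) -> J != 0%VS ->
  exists2 e, e \in J & e * e = e /\ e != 0.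
Proof.
have [n] := ubnP (\dim J); elim: n J => // n IH J dJ Jr J0.
have Jx := memv_pick J; move: (vpick J) Jx (vpick0 J) => x Jx.
rewrite (negPf J0) => /negbT x0.
have [b xbx] := prime_neq0 x0 x0; pose a := x * b.
have Ja : a \in J by apply: Jr.
pose K := (amull a @: J)%VS.
have sKJ : (K <= J)%VS.
  by apply/subvP=> _ /memv_imgP[y _ ->]; rewrite lfunE /= Jr.
have Kr : forall y c, y \in K -> y * c \in K.
  move=> _ c /memv_imgP[y Jy ->]; apply/memv_imgP; exists (y * c).
    exact: Jr.
  by rewrite !lfunE /= mulrA.
have K0 : K != 0%VS.
  apply: contraNneq xbx => K0; rewrite -memv0 -K0.
  by have := memv_img (amull a) Jx; rewrite lfunE.
have [eKJ|nKJ] := eqVneq K J; last first.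
  have dKJ : (\dim K < \dim J)%N.
    rewrite ltn_neqAle dimvS // andbT; apply: contra nKJ => dKJ.
    by rewrite -dimv_leqif_eq.
  have [|e Ke eP] := IH K _ Kr K0; first exact: leq_trans dKJ _.
  by exists e => //; apply: (subvP sKJ).
have := Ja; rewrite -{1}eKJ => /memv_imgP[e Je]; rewrite lfunE /= => ae.
exists e => //; split; last first.
  apply: contraNneq xbx => e0; move: ae; rewrite e0 mulr0.
  by rewrite /a => ->; rewrite mul0r.
have : \dim (J :&: lker (amull a)) = 0%N.
  apply/eqP; rewrite -(eqn_add2r (\dim K)) /K limg_ker_dim -/K eKJ //.
move/eqP; rewrite dimv_eq0 => /eqP K1.
apply/eqP; rewrite -subr_eq0 -memv0 -K1 memv_cap rpredB ?Jr //=.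
by rewrite memv_ker lfunE /= mulrBr mulrA -ae -ae subrr.
Qed.

(** Von Neumann regularity, by induction on the dimension of x B: an idempotent
e = x z of x B splits off the smaller right ideal of x' = x - e x, and a
quasi-inverse y of x' gives one of x because x' = x (1 - z x) = (1 - x z) x
(McCoy). *)
Lemma regular x : exists y, x * y * x = x.
Proof.
have [n] := ubnP (\dim (rideal x)); elim: n x => // n IH x dx.
have [->|x0] := eqVneq x 0; first by exists 0; rewrite !mul0r.
have xx : x \in rideal x by apply/ridealP; exists 1; rewrite mulr1.
have [||e ex [ee e0]] := @ex_idem (rideal x).
- by move=> _ b /ridealP[c ->]; rewrite -mulrA mem_rideal.
- by apply: contraNneq x0 => H; rewrite -memv0 -H.
have [z ez] := ridealP _ _ ex.
pose x' := x - e * x.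
have ex' : e * x' = 0 by rewrite /x' mulrBr mulrA ee subrr.
have [|y yP] := IH x'.
  rewrite ltnS in dx; apply: leq_trans dx; apply: (@proper_rideal _ _ e) => //.
    by apply: sub_rideal; apply: rpredB => //; rewrite {1}ez -mulrA mem_rideal.
  apply: contra e0 => /ridealP[b eb].
  by rewrite -ee {2}eb mulrA ex' mul0r.
exists ((1 - z * x) * y * (1 - e) + z).
have l : x * (1 - z * x) = x' by rewrite mulrBr mulr1 mulrA -ez.
have r : (1 - e) * x = x' by rewrite mulrBl mul1r.
by rewrite mulrDr mulrDl -ez !mulrA l -(mulrA (x' * y)) r yP /x' subrK.
Qed.

(** A pair (u, v) as below identifies a part u v of e with a part v u of f. When
both complements e - u v and f - v u are nonzero, primeness gives a nonzero x
from one to the other, regularity gives a quasi-inverse y of x, and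
(u + x, v + y) is a strictly larger identification. *)
Lemma extend_partial_iso e f u v : e * e = e -> f * f = f ->
  u * v * u = u -> v * u * v = v -> e * u = u -> u * f = u -> f * v = v ->
  v * e = v -> u * v != e -> v * u != f ->
  exists u' v', [/\ u' * v' * u' = u', v' * u' * v' = v', e * u' = u',
    u' * f = u' & f * v' = v'] /\ v' * e = v' /\
    (\dim (rideal (u * v)) < \dim (rideal (u' * v')))%N.
Proof.
move=> ee ff uvu vuv eu uf fv ve; rewrite eq_sym -subr_eq0 => e1.
rewrite eq_sym -subr_eq0 => f1.
have ve1 : v * (e - u * v) = 0 by rewrite mulrBr ve mulrA vuv subrr.
have e1u : (e - u * v) * u = 0 by rewrite mulrBl eu uvu subrr.
have uf1 : u * (f - v * u) = 0 by rewrite mulrBr uf mulrA uvu subrr.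
have f1v : (f - v * u) * v = 0 by rewrite mulrBl fv vuv subrr.
have ee1 : e * (e - u * v) = e - u * v by rewrite mulrBr ee mulrA eu.
have e1e : (e - u * v) * e = e - u * v by rewrite mulrBl ee -mulrA ve.
have ff1 : f * (f - v * u) = f - v * u by rewrite mulrBr ff mulrA fv.
have f1f : (f - v * u) * f = f - v * u by rewrite mulrBl ff -mulrA uf.
have e1e1 : (e - u * v) * (e - u * v) = e - u * v.
  by rewrite mulrBr e1e mulrA e1u mul0r subr0.
have f1f1 : (f - v * u) * (f - v * u) = f - v * u.
  by rewrite mulrBr f1f mulrA f1v mul0r subr0.
have [x [x0 e1x xf1]] :
    exists x, [/\ x != 0, (e - u * v) * x = x & x * (f - v * u) = x].
  have [b xb0] := prime_neq0 e1 f1.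
  by exists ((e - u * v) * b * (f - v * u)); rewrite -!mulrA f1f1 !mulrA e1e1.
have [y0 xyx] := regular x.
have [y yE] : exists y, y = (f - v * u) * y0 * x * y0 * (e - u * v) by eexists.
have vx : v * x = 0 by rewrite -e1x mulrA ve1 mul0r.
have xv : x * v = 0 by rewrite -xf1 -mulrA f1v mulr0.
have uy : u * y = 0 by rewrite yE !mulrA uf1 !mul0r.
have yu : y * u = 0 by rewrite yE -!mulrA e1u !mulr0.
have exx : e * x = x by rewrite -e1x mulrA ee1.
have xfx : x * f = x by rewrite -xf1 -mulrA f1f.
have fy : f * y = y by rewrite yE !mulrA ff1.
have ye : y * e = y by rewrite yE -!mulrA e1e.
have xy : x * y = x * y0 * (e - u * v).
  by rewrite yE !mulrA xf1 xyx.
have xyx' : x * y * x = x by rewrite xy -mulrA e1x.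
have yx : y * x = (f - v * u) * y0 * x.
  by rewrite yE -(mulrA _ _ x) e1x -!mulrA (mulrA x) xyx.
have yxy : y * x * y = y by rewrite yx -mulrA xy yE !mulrA.
have m1 : (u + x) * (v + y) = u * v + x * y.
  by rewrite mulrDl !mulrDr uy xv addr0 add0r.
have m2 : (v + y) * (u + x) = v * u + y * x.
  by rewrite mulrDl !mulrDr vx yu addr0 add0r.
exists (u + x), (v + y); split; [split|split].
- by rewrite m1 mulrDl !mulrDr uvu xyx' -!mulrA vx yu !mulr0 addr0 add0r.
- by rewrite m2 mulrDl !mulrDr vuv yxy -!mulrA uy xv !mulr0 addr0 add0r.
- by rewrite mulrDr eu exx.
- by rewrite mulrDl uf xfx.
- by rewrite mulrDr fv fy.
- by rewrite mulrDl ve ye.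
rewrite m1; apply: (@proper_rideal _ _ (x * y)).
- apply: sub_rideal; apply/ridealP; exists (u * v).
  by rewrite mulrDl mulrA uvu -mulrA (mulrA y) yu mul0r mulr0 addr0.
- apply/ridealP; exists (x * y).
  rewrite mulrDl (mulrA (x * y)) xyx'.
  by rewrite -(mulrA u) (mulrA v) vx mul0r mulr0 add0r.
apply: contra x0 => /ridealP[c xyc].
have : v * (x * y) = 0 by rewrite mulrA vx mul0r.
rewrite xyc !mulrA vuv => vc.
by rewrite -xyx' xyc -!mulrA (mulrA v) vc mul0r mulr0.
Qed.

(** Enlarge partial identifications of e with f until one of the complements
vanishes; the equality of dimensions then makes the other vanish too. *)
Lemma equiv_idem_dim e f : e * e = e -> f * f = f ->
  \dim (rideal e) = \dim (rideal f) -> equiv_idem e f.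
Proof.
move=> ee ff def.
(* Each enlargement lowers the codimension of (u v) B, which is below n. *)
suff H n u v : (\dim {:B} < n + \dim (rideal (u * v)))%N ->
    [/\ u * v * u = u, v * u * v = v, e * u = u, u * f = u & f * v = v] ->
    v * e = v -> equiv_idem e f.
  by apply: (H (\dim {:B}).+1 0 0); rewrite ?leq_addr ?mul0r ?mulr0.
elim: n u v => [|n IH] u v dn [uvu vuv eu uf fv] ve.
  by move: dn; rewrite add0n ltnNge dimvS ?subvf.
have duv : \dim (rideal (u * v)) = \dim (rideal (v * u)).
  apply/eqP; rewrite eqn_leq; apply/andP; split.
    apply: leq_trans (dim_rideal_mulr _ _) _.
    by rewrite -{1}uvu -mulrA dim_rideal_mull.
  apply: leq_trans (dim_rideal_mulr _ _) _.
  by rewrite -{1}vuv -mulrA dim_rideal_mull.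
have [uve|nuv] := eqVneq (u * v) e.
  exists u, v; split=> //.
  apply: idem_eq; rewrite ?mulrA ?fv ?vuv -?mulrA ?uf //.
  by rewrite -duv uve.
have [vuf|nvu] := eqVneq (v * u) f.
  exists u, v; split=> //.
  apply: idem_eq; rewrite ?mulrA ?eu ?uvu -?mulrA ?ve //.
  by rewrite duv vuf.
have [u' [v' [P [ve' d]]]] :=
  extend_partial_iso ee ff uvu vuv eu uf fv ve nuv nvu.
apply: (IH u' v') => //.
by apply: leq_trans dn _; rewrite addSn -addnS leq_add2l.
Qed.

End PrimeAlgebra.

(** * Matrix algebras as algebras over the ground field *)

(** An alias of the matrix ring, since scalars act on it through F here, and
through A on the matrix type itself. *)
Definition matalg (F : fieldType) (A : falgType F) (n : nat) : Type :=
  'M[A]_n.+1.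

Import VectorInternalTheory.

Section MatrixAlgebra.
Variables (F : fieldType) (A : falgType F) (n : nat).
Local Notation B := (matalg A n).

HB.instance Definition _ := GRing.NzRing.copy B 'M[A]_n.+1.

Definition mat_scale (c : F) (M : B) : B := c%:A *: (M : 'M[A]_n.+1).

Lemma mat_scaleE c (M : B) i j :
  (mat_scale c M : 'M[A]_n.+1) i j = c *: (M : 'M[A]_n.+1) i j.
Proof. by rewrite mxE mulr_algl. Qed.

Let scaleA c d M : mat_scale c (mat_scale d M) = mat_scale (c * d) M.
Proof. by apply/matrixP => i j; rewrite !mat_scaleE scalerA. Qed.
Let scale1 : left_id 1 mat_scale.
Proof. by move=> M; apply/matrixP => i j; rewrite !mat_scaleE scale1r. Qed.
Let scaleDr : right_distributive mat_scale +%R.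
Proof.
by move=> c M N; apply/matrixP => i j; rewrite !(mat_scaleE, mxE) scalerDr.
Qed.
Let scaleDl M : {morph mat_scale^~ M : c d / c + d}.
Proof.
by move=> c d; apply/matrixP => i j; rewrite !(mat_scaleE, mxE) scalerDl.
Qed.

HB.instance Definition _ :=
  GRing.Zmodule_isLmodule.Build F B scaleA scale1 scaleDr scaleDl.

Lemma matZE c (M : B) i j :
  (c *: M : 'M[A]_n.+1) i j = c *: (M : 'M[A]_n.+1) i j.
Proof. exact: mat_scaleE. Qed.

Let scaleAl c (M N : B) : c *: (M * N) = (c *: M) * N.
Proof. by rewrite /GRing.scale /= /mat_scale -[M * N]/(M *m N) scalemxAl. Qed.

HB.instance Definition _ := GRing.Lmodule_isLalgebra.Build F B scaleAl.

Let scaleAr c (M N : B) : c *: (M * N) = M * (c *: N).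
Proof.
apply/matrixP => i j; rewrite matZE -[M * N]/(M *m N) -[RHS]/((M *m _) i j).
rewrite !mxE scaler_sumr; apply: eq_bigr => k _.
by rewrite matZE scalerAr.
Qed.

HB.instance Definition _ := GRing.Lalgebra_isAlgebra.Build F B scaleAr.

Let coords (M : B) : {ffun 'I_n.+1 * 'I_n.+1 -> A} :=
  [ffun p => (M : 'M[A]_n.+1) p.1 p.2].

Lemma mat_vect_iso :
  Vector.axiom (dim {ffun 'I_n.+1 * 'I_n.+1 -> A}) B.
Proof.
exists (fun M => v2r (coords M)).
  move=> c M N; rewrite -linearP; congr v2r; apply/ffunP => p.
  by rewrite !ffunE mxE matZE.
exists (fun r => \matrix_(i, j)
  (r2v r : {ffun 'I_n.+1 * 'I_n.+1 -> A}) (i, j)).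
  by move=> M; apply/matrixP => i j; rewrite mxE v2rK ffunE.
move=> r; rewrite -[RHS]r2vK; congr v2r; apply/ffunP => -[i j].
by rewrite ffunE mxE.
Qed.

HB.instance Definition _ := Lmodule_hasFinDim.Build F B mat_vect_iso.
HB.instance Definition _ := Algebra_isFalgebra.Build F B.

Lemma dim_matalg : \dim {:B} = (n.+1 * n.+1 * \dim {:A})%N.
Proof.
rewrite !dimvf -[dim B]/(#|{: 'I_n.+1 * 'I_n.+1}| * dim A)%N.
by rewrite card_prod card_ord.
Qed.

Definition unit_mat (i j : 'I_n.+1) (a : A) : B := a *: delta_mx i j.

Lemma unit_matE i j a k l :
  (unit_mat i j a : 'M[A]_n.+1) k l = if (k == i) && (l == j) then a else 0.
Proof. by rewrite !mxE; case: ifP => _; rewrite ?mulr1 ?mulr0. Qed.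

Lemma mul_unit_mat (M N : B) i j a k l :
  (M * unit_mat i j a * N : 'M[A]_n.+1) k l =
  (M : 'M[A]_n.+1) k i * a * (N : 'M[A]_n.+1) j l.
Proof.
rewrite -[_ * N]/(_ *m N) mxE (bigD1 j) //= big1 ?addr0 => [|p pj].
  rewrite -[M * _]/(M *m _) mxE (bigD1 i) //= big1 ?addr0 => [|q qi].
    by rewrite unit_matE !eqxx.
  by rewrite unit_matE (negPf qi) mulr0.
rewrite -[M * _]/(M *m _) mxE big1 ?mul0r // => q _.
by rewrite unit_matE (negPf pj) andbF mulr0.
Qed.

Lemma prime_matalg : prime_alg A -> prime_alg B.
Proof.
move=> primeA M N MN.
have [->|M0] := eqVneq M 0; first by left.
have [->|N0] := eqVneq N 0; first by right.
have ex (P : B) : P != 0 -> exists i j, (P : 'M[A]_n.+1) i j != 0.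
  move=> P0; have [/existsP[i /existsP[j Pij]]|] :=
    boolP [exists i, exists j, (P : 'M[A]_n.+1) i j != 0]; first by exists i, j.
  move=> H; case/eqP: P0; apply/matrixP => i j; rewrite mxE; apply/eqP.
  by apply: contraNT H => Pij; apply/existsP; exists i; apply/existsP; exists j.
have [k [i /eqP Mki]] := ex M M0; have [j [l /eqP Njl]] := ex N N0.
case: (primeA ((M : 'M[A]_n.+1) k i) ((N : 'M[A]_n.+1) j l)) => // a.
by rewrite -mul_unit_mat MN mxE.
Qed.

Lemma unit_matM i a b :
  unit_mat i i a * unit_mat i i b = unit_mat i i (a * b).
Proof.
apply/matrixP => k l; rewrite -[LHS]/((_ *m _) k l) mxE (bigD1 i) //= big1.
  by rewrite addr0 !unit_matE eqxx andbT /=; case: eqP; case: eqP;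
     rewrite ?mulr0 ?mul0r.
by move=> p pi; rewrite unit_matE (negPf pi) andbF mul0r.
Qed.

Lemma dim_unit_mat i :
  \dim (amull (unit_mat i i 1) @: fullv) = (n.+1 * \dim {:A})%N.
Proof.
(* The right ideal of the matrix unit consists of the matrices supported on
   row i. *)
pose g (r : {ffun 'I_n.+1 -> A}) : B :=
  \matrix_(k, l) (if k == i then r l else 0).
have gZ : linear g.
  move=> c r s; apply/matrixP => k l; rewrite 2!mxE matZE !mxE !ffunE.
  by case: ifP => // _; rewrite scaler0 addr0.
pose gL : {linear _ -> _} := HB.pack g (GRing.isLinear.Build _ _ _ _ g gZ).
have -> : (amull (unit_mat i i 1) @: fullv)%VS = limg (linfun gL).
  apply/vspaceP => M; apply/memv_imgP/memv_imgP => -[X _ ->].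
    exists [ffun l => (X : 'M[A]_n.+1) i l]; first exact: memvf.
    rewrite !lfunE /=; apply/matrixP => k l; rewrite [RHS]mxE ffunE.
    rewrite -[_ * X]mul1r mulrA mul_unit_mat mulr1 -[1]/(1%:M) mxE.
    by case: (k == i); rewrite ?mul1r ?mul0r.
  exists (g X); first exact: memvf.
  rewrite !lfunE /=; apply/matrixP => k l; rewrite [LHS]mxE.
  rewrite -[_ * g X]mul1r mulrA mul_unit_mat mulr1 -[1]/(1%:M) !mxE eqxx.
  by case: (k == i); rewrite ?mul1r ?mul0r.
rewrite limg_dim_eq.
  by rewrite !dimvf -[X in X = _]/(#|'I_n.+1| * dim A)%N card_ord.
apply/eqP; rewrite -subv0; apply/subvP => r; rewrite memv_cap memv_ker memv0.
case/andP => _; rewrite lfunE /= => /eqP /matrixP gr; apply/eqP/ffunP => l.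
by have := gr i l; rewrite !mxE eqxx ffunE.
Qed.

End MatrixAlgebra.

(** * Cancelling matrices in a Brauer equivalence *)

Lemma dim_inj (F : fieldType) (U V : vectType F) (g : {linear U -> V})
    (W : {vspace U}) :
  injective g -> \dim (linfun g @: W) = \dim W.
Proof.
move=> gi; rewrite limg_dim_eq //; apply/eqP; rewrite -subv0.
apply: subv_trans (capvSr _ _) _; rewrite subv0; apply/lker0P => x y.
by rewrite !lfunE /=; apply: gi.
Qed.

Lemma corner_unit_mat (F : fieldType) (A : falgType F) n (i : 'I_n.+1)
    (M : matalg A n) :
  unit_mat i i (1 : A) * M * unit_mat i i 1
  = unit_mat i i ((M : 'M[A]_n.+1) i i).
Proof.
apply/matrixP => k l.
have -> : unit_mat i i (1 : A) * M * unit_mat i i 1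
  = (1 * unit_mat i i 1 * M) * unit_mat i i 1 * 1 by rewrite mul1r mulr1.
rewrite !mul_unit_mat unit_matE !mulr1 -[1]/(1%:M) !mxE (eq_sym l).
by case: (k == i); case: (i == l); rewrite ?mulr1 ?mulr0 ?mul1r ?mul0r.
Qed.

(** Let e in M_n(A) be the image of the matrix unit E_00 of M_n(B). It generates
a right ideal of the same dimension as E_00 does in M_n(A), so e = u v and
E_00 = v u. Then b |-> v (b E_00) u maps B to the corner E_00 M_n(A) E_00,
which is A. *)
Lemma brauer_eq_hom (F : fieldType) (A B : falgType F) :
  prime_alg A -> \dim {:A} = \dim {:B} -> brauer_eq A B ->
  inhabited {lrmorphism B -> A}.
Proof.
move=> primeA dAB [m [n [f [[f' fK f'K] fZ]]]].
pose gf : matalg A m -> matalg B n := f.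
pose g : matalg B n -> matalg A m := f'.
have gfL : linear gf by move=> c x y; rewrite /gf rmorphD /= fZ.
have gL : linear g.
  by move=> c x y; apply: (can_inj fK); rewrite f'K -/gf gfL /gf /g !f'K.
have gM x y : g (x * y) = g x * g y.
  by apply: (can_inj fK); rewrite f'K rmorphM /= /g !f'K.
pose gfl : {linear _ -> _} := HB.pack gf (GRing.isLinear.Build _ _ _ _ gf gfL).
pose gl : {linear _ -> _} := HB.pack g (GRing.isLinear.Build _ _ _ _ g gL).
have gi : injective gl := can_inj f'K.
have emn : m = n.
  have d0 : (0 < \dim {:B})%N.
    rewrite lt0n dimv_eq0; apply/eqP => /vspaceP/(_ 1).
    by rewrite memvf memv0 oner_eq0.
  apply/eqP; rewrite -eqSS -(eqn_exp2r _ _ (isT : 0 < 2)%N) -!mulnn.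
  rewrite -(eqn_pmul2r d0) -{1}dAB -!dim_matalg eqn_leq.
  rewrite -{1}(dim_inj _ (can_inj fK : injective gfl)) dimvS ?subvf //=.
  by rewrite -(dim_inj _ gi) dimvS ?subvf.
subst m; pose E (C : falgType F) (c : C) := unit_mat (ord0 : 'I_n.+1) ord0 c.
have EM (C : falgType F) (c d : C) : E C c * E C d = E C (c * d).
  exact: unit_matM.
pose e := g (E B 1).
have ee : e * e = e by rewrite /e -gM EM mulr1.
have [|u [v [uv vu eu ve]]] := equiv_idem_dim (prime_matalg primeA) ee
    (etrans (EM _ _ _) (congr1 (E A) (mulr1 1)) : E A 1 * E A 1 = E A 1).
  rewrite [RHS]dim_unit_mat dAB -(dim_unit_mat B (ord0 : 'I_n.+1)).
  rewrite -(dim_inj _ gi).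
  congr (\dim _); apply/vspaceP => x; apply/memv_imgP/memv_imgP.
    case=> y _ ->; exists (E B 1 * f y).
      by apply/ridealP; exists (f y).
    by rewrite !lfunE /= gM [g (f y)]fK.
  case=> y /ridealP[b ->] ->; exists (g b); first exact: memvf.
  by rewrite !lfunE /= gM.
have EvE : E A 1 * v = v by rewrite -vu -mulrA uv ve.
have uE : u * E A 1 = u by rewrite -vu mulrA uv eu.
pose h (b : B) : A := (v * g (E B b) * u : 'M[A]_n.+1) ord0 ord0.
have hE b : E A (h b) = v * g (E B b) * u.
  by rewrite /h /E -corner_unit_mat -/(E A 1) !mulrA EvE -!mulrA uE.
have Einj : injective (E A).
  by move=> x y /matrixP /(_ ord0 ord0); rewrite !unit_matE !eqxx.
have EL (C : falgType F) : linear (E C).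
  move=> c x y; apply/matrixP => i j; rewrite [RHS]mxE matZE !unit_matE.
  by case: ifP; rewrite ?scaler0 ?addr0.
have hL : linear h.
  move=> c x y; apply: Einj; rewrite EL !hE EL gL mulrDr mulrDl.
  by rewrite -scalerAr -scalerAl.
have hM : monoid_morphism h.
  split; first by apply: Einj; rewrite hE -/e ve vu.
  move=> x y; apply: Einj; rewrite -EM !hE.
  rewrite !mulrA -(mulrA _ u v) uv -[_ * e](mulrA v) -gM EM mulr1.
  by rewrite -(mulrA v (g _) (g _)) -gM EM.
pose hl : {lrmorphism B -> A} := HB.pack h
  (GRing.isLinear.Build _ _ _ _ h hL) (GRing.isMonoidMorphism.Build _ _ h hM).
by exists.
Qed.

(** * Quaternion algebras by generators and relations *)

(** If x B y = 0, the two-sided ideal B x B lies in the left annihilator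
of y. *)
Lemma simple_prime (F : fieldType) (A : falgType F) :
  simple_alg A -> prime_alg A.
Proof.
move=> simA x y xy.
pose K := lker (amulr y); pose I := ({:A} * (<[x]> * {:A}))%VS.
have memK z : (z \in K) = (z * y == 0) by rewrite memv_ker lfunE.
have sxK : (<[x]> * {:A} <= K)%VS.
  apply/prodvP => _ b /vlineP[c ->] _.
  by rewrite memK -!scalerAl xy scaler0.
have sIK : (I <= K)%VS.
  apply/prodvP => b z _ /(subvP sxK); rewrite !memK -mulrA => /eqP ->.
  by rewrite mulr0.
have xI : x \in I.
  rewrite -[x]mul1r -[1 * x]mulr1 -mulrA.
  by rewrite !memv_mul ?memvf ?memv_line.
have [||I0|IA] := simA I.
- by rewrite prodvA prodvSl ?subvf.
- by rewrite -!prodvA !prodvSr ?subvf.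
- by left; apply/eqP; rewrite -memv0 -I0.
right; have : 1 \in K by apply: (subvP sIK); rewrite IA memvf.
by rewrite memK mul1r => /eqP.
Qed.

Lemma simple_hom_inj (F : fieldType) (A B : falgType F)
    (g : {lrmorphism A -> B}) : simple_alg A -> injective g.
Proof.
move=> simA; pose K := lker (linfun g).
have memK z : (z \in K) = (g z == 0) by rewrite memv_ker lfunE.
have [||K0|KA] := simA K.
- apply/prodvP => x y _; rewrite !memK rmorphM /= => /eqP ->.
  by rewrite mulr0.
- apply/prodvP => x y; rewrite !memK rmorphM /= => /eqP -> _.
  by rewrite mul0r.
- by apply: raddf_inj => x /eqP; rewrite -memK K0 memv0 => /eqP.
have : 1 \in K by rewrite KA memvf.
by rewrite memK rmorph1 oner_eq0.
Qed.

Lemma hom_bij (F : fieldType) (A B : falgType F) (g : {lrmorphism A -> B}) :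
  simple_alg A -> \dim {:A} = \dim {:B} -> bijective g.
Proof.
move=> simA dAB; have gi := simple_hom_inj (g := g) simA.
have k0 : lker (linfun g) == 0%VS.
  by apply/lker0P => x y; rewrite !lfunE; apply: gi.
have im : limg (linfun g) = fullv.
  by apply/eqP; rewrite -dimv_leqif_eq ?subvf // dim_inj // dAB.
exists (linfun g)^-1%VF => x.
  by rewrite -[g x](lfunE g) lker0_lfunK.
by rewrite -[g _](lfunE g) limg_lfunVK // im memvf.
Qed.

Definition quat_gens (F : fieldType) (A : falgType F) (u w a b : F) (i j : A) :=
  [/\ i ^+ 2 = u *: i + a%:A, j ^+ 2 = b%:A & i * j + j * i = u *: j + w%:A].

Lemma quat_gens_hom (F : fieldType) (A B : falgType F)
    (g : {lrmorphism A -> B}) u w a b (i j : A) :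
  quat_gens u w a b i j -> quat_gens u w a b (g i) (g j).
Proof.
case=> ii jj ij; split.
- by rewrite -rmorphXn ii rmorphD /= !linearZ_LR /= rmorph1.
- by rewrite -rmorphXn jj /= linearZ_LR rmorph1.
by rewrite -!rmorphM -rmorphD ij rmorphD /= !linearZ_LR /= rmorph1.
Qed.

Lemma quat_gens_std (F : fieldType) (u w a b : F) :
  quat_gens u w a b (qi u w a b) (qj u w a b).
Proof. by split; [apply: quat_ii | apply: quat_jj | apply: quat_ij_ji]. Qed.

Section QuatHom.
Variables (F : fieldType) (A : falgType F) (u w a b : F) (i j : A).
Hypothesis gens : quat_gens u w a b i j.
Local Notation H := (quat u w a b).
Let I : H := qi u w a b.
Let J : H := qj u w a b.

Let g (x : H) : A :=
  (qc x 0)%:A + qc x 1 *: i + qc x 2 *: j + qc x 3 *: (i * j).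

Let gL : linear g.
Proof.
move=> c x y; rewrite /g !(qcD, qcZ) !scalerDl !scalerDr !scalerA.
by rewrite [RHS]addrACA [X in _ = X + _]addrACA [X in _ = X + _ + _]addrACA.
Qed.

Let gl : {linear H -> A} := HB.pack g (GRing.isLinear.Build _ _ _ _ g gL).

Let g1 : g 1 = 1.
Proof. by rewrite /g !qcalc !scale0r !addr0 scale1r. Qed.

Let gI : g I = i.
Proof. by rewrite /g !qcalc !scale0r !addr0 add0r scale1r. Qed.
Let gJ : g J = j.
Proof. by rewrite /g !qcalc !scale0r !addr0 !add0r scale1r. Qed.
Let gIJ : g (I * J) = i * j.
Proof.
rewrite /g !qcalc !(mul0r, mulr0, mul1r, mulr1, addr0, add0r, subr0, subrr).
by rewrite oppr0 !scale0r !add0r scale1r.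
Qed.

Let gD x y : g (x + y) = g x + g y. Proof. exact: (raddfD gl). Qed.
Let gN x : g (- x) = - g x. Proof. exact: (raddfN gl). Qed.
Let gZ c x : g (c *: x) = c *: g x. Proof. exact: (linearZ_LR gl). Qed.

Let linE := (gD, gN, gZ, g1, gI, gJ, gIJ).

Let gmul (X : H) : g (X * I) = g X * i -> g (X * J) = g X * j ->
  g (X * (I * J)) = g X * (i * j) -> forall y, g (X * y) = g X * g y.
Proof.
move=> XI XJ XIJ y.
rewrite [in RHS]/(g y) {1}[y]quat_coord !mulrDr -!scalerAr !mulr1 !gD !gZ.
by rewrite XI XJ XIJ.
Qed.

Let gMI : forall y, g (I * y) = i * g y.
Proof.
case: gens => ii jj ij; rewrite -gI; apply: gmul; rewrite ?linE //.
  by rewrite -!expr2 quat_ii !linE ii.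
by rewrite !mulrA -!expr2 quat_ii ii !mulrDl -!scalerAl !mul1r !linE.
Qed.

Let gMJ : forall y, g (J * y) = j * g y.
Proof.
case: gens => ii jj ij.
have JI : J * I = u *: J + w%:A - I * J.
  by rewrite -quat_ij_ji addrAC subrr add0r.
have ji : j * i = u *: j + w%:A - i * j by rewrite -ij addrAC subrr add0r.
rewrite -gJ; apply: gmul; rewrite ?gJ.
- by rewrite JI ji !linE.
- by rewrite -!expr2 quat_jj jj !linE.
rewrite !mulrA JI ji !(mulrDl, mulNr) -!mulrA -!expr2 quat_jj jj.
by rewrite -!(scalerAl, scalerAr) !mul1r !mulr1 !linE -!expr2 quat_jj jj !linE.
Qed.

(** The relations determine the product of the basis 1, i, j, ij, so that
multiplicativity reduces to left multiplication by i and by j on that basis. *)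
Lemma quat_hom :
  exists h : {lrmorphism H -> A}, h I = i /\ h J = j.
Proof.
have gM : monoid_morphism g.
  split=> // x y.
  rewrite {1}[x]quat_coord !mulrDl -!scalerAl mul1r -mulrA !gD !gZ !gMI gMJ.
  by rewrite mul1r mulrA.
pose h : {lrmorphism H -> A} := HB.pack g
  (GRing.isLinear.Build _ _ _ _ g gL) (GRing.isMonoidMorphism.Build _ _ g gM).
by exists h.
Qed.
End QuatHom.

Section BrauerQuat.
Variables (F : fieldType) (Q : falgType F).
Hypotheses (ch2 : 2%N \in [pchar F]) (quatQ : quaternion_algebra Q).
Variables (u w a b : F).
Hypothesis d0 : w ^+ 2 - u ^+ 2 * b != 0.

Lemma quat_iso (i j : Q) : quat_gens u w a b i j ->
  exists h : {lrmorphism quat u w a b -> Q},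
    [/\ bijective h, h (qi u w a b) = i & h (qj u w a b) = j].
Proof.
move=> /quat_hom [h [hi hj]]; exists h; split=> //.
case: quatQ => _ dQ; case: (quat_quaternion a ch2 d0) => -[_ simH] dH.
by apply: hom_bij; rewrite // dQ.
Qed.

(** The dictionary between Brauer classes and elements of Q: a homomorphism from
the algebra to Q yields the generators, and conversely generators yield such a
homomorphism, which is bijective because its source is simple and of the same
dimension. *)
Lemma brauer_eq_quatP :
  brauer_eq Q (quat u w a b) <-> exists i j : Q, quat_gens u w a b i j.
Proof.
case: (quatQ) => -[_ simQ] dQ; split=> [QH | [i [j /quat_iso[h [hbij _ _]]]]].
  have dQH : \dim {:Q} = \dim {:quat u w a b} by rewrite dQ quat_dim.
  have [g] := brauer_eq_hom (simple_prime simQ) dQH QH.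
  exists (g (qi u w a b)), (g (qj u w a b)).
  exact/quat_gens_hom/quat_gens_std.
case: hbij => h' hK h'K.
have hL c x y : h (c *: x + y) = c *: h x + h y := linearP h c x y.
have h'L : linear h'.
  by move=> c x y; apply: (can_inj hK); rewrite hL !h'K.
have h1 : h 1 = 1 := rmorph1 h.
have hM x y : h (x * y) = h x * h y := rmorphM h x y.
have h'M : monoid_morphism h'.
  by split=> [|x y]; apply: (can_inj hK); rewrite ?hM !h'K ?h1.
pose k : {lrmorphism Q -> quat u w a b} := HB.pack h'
  (GRing.isLinear.Build _ _ _ _ h' h'L)
  (GRing.isMonoidMorphism.Build _ _ h' h'M).
exists 0%N, 0%N, (map_mx k); split.
  by exists (map_mx h) => M; apply/matrixP => p q; rewrite !mxE /= (hK, h'K).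
move=> c M; apply/matrixP => p q; rewrite !mxE !mulr_algl.
exact: (linearZ_LR k).
Qed.
End BrauerQuat.

(** * Common slots in coordinates *)

Lemma quat_gens_inj (F : fieldType) (A B : falgType F)
    (g : {lrmorphism A -> B}) u w a b (i j : A) :
  injective g -> quat_gens u w a b (g i) (g j) -> quat_gens u w a b i j.
Proof.
move=> gi [ii jj ij]; split; apply: gi.
- by rewrite rmorphXn ii rmorphD /= !linearZ_LR rmorph1.
- by rewrite rmorphXn jj /= linearZ_LR rmorph1.
by rewrite !rmorphD !rmorphM /= ij !linearZ_LR rmorph1.
Qed.

(** The algebra with parameters u, w, a, b is simple when w^2 - u^2 b <> 0,
which is how b <> 0 enters for the symbol [a,b). *)
Lemma as_disc (F : fieldType) (b : F) : b != 0 -> 0 ^+ 2 - 1 ^+ 2 * b != 0.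
Proof. by rewrite expr0n expr1n mul1r sub0r oppr_eq0. Qed.

Lemma bi_disc (F : fieldType) (b : F) : 1 ^+ 2 - 0 ^+ 2 * b != 0.
Proof. by rewrite expr0n expr1n mul0r subr0 oner_eq0. Qed.

Section Coordinates.
Variables (F : fieldType) (ch2 : 2%N \in [pchar F]).

(** Reduces an identity in characteristic 2 to a polynomial identity over the
integers, with z the explicit half of the difference. *)
Let eq2 (z x y : F) : x - y = z + z -> x = y.
Proof.
move=> xy; apply/eqP; rewrite -subr_eq0 xy.
by rewrite -mulr2n -mulr_natl (pcharf0 ch2) mul0r.
Qed.

(** An element outside F has only one quadratic equation over F, whose linear
coefficient is the reduced trace; neither i nor j lies in F, since otherwise
u j + w = 0, and squaring contradicts w^2 <> u^2 b'. *)
Lemma quat_gens_trace (u w a b a' b' : F) (i j : quat u w a b) :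
  w ^+ 2 - u ^+ 2 * b' != 0 -> quat_gens u w a' b' i j ->
  [/\ u * qc i 1 + w * qc i 3 = u, u * qc j 1 + w * qc j 3 = 0
    & [|| qc j 1 != 0, qc j 2 != 0 | qc j 3 != 0]].
Proof.
move=> d0 [ii jj ij].
have dbl (x : quat u w a b) : x + x = 0.
  by rewrite -mulr2n -scaler_nat (pcharf0 ch2) scale0r.
have tr (x : quat u w a b) t c : x ^+ 2 = t *: x + c%:A ->
    (exists k, x = k%:A) \/ u * qc x 1 + w * qc x 3 = t.
  move=> xx; pose s := u * qc x 1 + w * qc x 3.
  have [|st] := eqVneq s t; [by right | left].
  have : exists n, x ^+ 2 = s *: x + n%:A.
    pose n := qc (x * x) 0 - s * qc x 0; exists n; rewrite expr2.
    apply: quat_eqP; rewrite !qcalc /n ?qcalc /s; first by ring.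
    - by apply: (eq2 (z := qc x 0 * qc x 1)); ring.
    - by apply: (eq2 (z := qc x 0 * qc x 2)); ring.
    - by apply: (eq2 (z := qc x 0 * qc x 3)); ring.
  case=> n; rewrite xx => E.
  exists ((s - t)^-1 * (c - n)).
  have -> : x = (s - t)^-1 *: ((s - t) *: x).
    by rewrite scalerA mulVf ?subr_eq0 // scale1r.
  rewrite -scalerA; congr (_ *: _); apply: (addIr (t *: x + n%:A)).
  by rewrite !scalerBl addrA subrK addrCA subrK.
have nc : i * j + j * i != 0.
  apply: contra d0; rewrite ij addr_eq0 => /eqP /(congr1 (fun x => x ^+ 2)).
  rewrite sqrrN !exprZn jj expr1n scalerA => /eqP.
  rewrite -subr_eq0 -scalerBl scaler_eq0 oner_eq0 orbF.
  by rewrite -oppr_eq0 opprB.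
have ni k : i <> k%:A.
  move=> ik; case/eqP: nc; rewrite ik -scalerAl -scalerAr mul1r mulr1.
  exact: dbl.
have nj k : j <> k%:A.
  move=> jk; case/eqP: nc; rewrite jk -scalerAl -scalerAr mul1r mulr1.
  exact: dbl.
split.
- by case: (tr i _ _ ii) => // -[k /ni].
- case: (tr j 0 b'); rewrite ?jj ?scale0r ?add0r //.
  by case=> k /nj.
apply/negPn; rewrite !negb_or !negbK; apply/negP.
case/and3P=> /eqP j1 /eqP j2 /eqP j3.
by apply: (nj (qc j 0)); rewrite {1}[j]quat_coord j1 j2 j3 !scale0r !addr0.
Qed.

Section ArtinSchreier.
Variables a b : F.
Local Notation T := (quat 1 0 a b).
Local Notation mk := (mkquat 1 0 a b).

(** The plane orthogonal to F(i) is F(i) j, and its norm form is b times the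
norm form of F(i). *)
Lemma as_pure_gens p q : quat_gens 1 0 a (b * (p ^+ 2 + p * q - a * q ^+ 2))
  (qi 1 0 a b) (mk 0 0 p q).
Proof.
split; first exact: quat_ii.
  by apply: quat_eqP; rewrite expr2 !qcalc; ring.
by apply: quat_eqP; rewrite !qcalc; ring.
Qed.

Lemma as_pureP (x : T) :
  qi 1 0 a b * x + x * qi 1 0 a b = x -> x = mk 0 0 (qc x 2) (qc x 3).
Proof.
move=> xE; have x0 : qc x 0 = 0.
  by rewrite -xE !qcalc; apply: (eq2 (z := a * qc x 1)); ring.
have x1 : qc x 1 = 0.
  by rewrite -xE !qcalc; apply: (eq2 (z := qc x 0 + qc x 1)); ring.
by apply: quat_eqP; rewrite qcE.
Qed.

(** An isotropic vector (p, q) of a nondegenerate plane is not orthogonal to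
the anisotropic vector (1, 0), so that adding multiples of it to (1, 0) reaches
every value; the multiple s is chosen to reach 1. *)
Lemma as_isotropic p q : b != 0 -> (p != 0) || (q != 0) ->
  p ^+ 2 + p * q - a * q ^+ 2 = 0 ->
  exists p' q', b * (p' ^+ 2 + p' * q' - a * q' ^+ 2) = 1.
Proof.
move=> b0 pq0 N0.
have q0 : q != 0.
  apply: contraTneq pq0 => q0; move/eqP: N0.
  by rewrite q0 mulr0 addr0 expr0n mulr0 subr0 expf_eq0 /= eqxx orbF => ->.
pose s := (b^-1 - 1) / q; exists (1 + s * p), (s * q).
apply: (eq2 (z := b * s * p)).
have -> :
  b * ((1 + s * p) ^+ 2 + (1 + s * p) * (s * q) - a * (s * q) ^+ 2) - 1 =
  b * s * p + b * s * p + b * s ^+ 2 * (p ^+ 2 + p * q - a * q ^+ 2) +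
  (b * (1 + s * q) - 1) by ring.
by rewrite N0 /s; field; rewrite ?b0 ?q0.
Qed.

(** The first hypothesis says that i = (0, 1, t, c), which has trace 1, is
orthogonal to j = (y0, 0, y2, y3). *)
Lemma as_slot_gens t c y0 y2 y3 b' : b * (t * y3 + c * y2) = y0 ->
  mk y0 0 y2 y3 ^+ 2 = b'%:A ->
  quat_gens 1 0 (a + b * t ^+ 2 + b * t * c - a * b * c ^+ 2) b'
    (mk 0 1 t c) (mk y0 0 y2 y3).
Proof.
move=> <- jj; split=> //.
  by apply: quat_eqP; rewrite expr2 !qcalc; ring.
set y := b * _; apply: quat_eqP; rewrite !qcalc.
- by apply: (eq2 (z := b * t * y2 - a * b * c * y3)); rewrite /y; ring.
- by apply: (eq2 (z := y)); ring.
- by apply: (eq2 (z := t * y)); ring.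
- by apply: (eq2 (z := c * y)); ring.
Qed.

(** If y3 <> 0 then 1, j1 and j are independent and one i serves both. If y3 = 0
then j = y0 + y2 j1; the orthogonality determines c, and t = a c equalises the
norms of (0, 1, t, 0) and (0, 1, t, c). *)
Lemma as_common_left (b' : F) (j : T) : b != 0 -> qc j 1 = 0 ->
  (qc j 2 != 0) || (qc j 3 != 0) -> j ^+ 2 = b'%:A ->
  exists a0 (i i' : T),
    quat_gens 1 0 a0 b i (qj 1 0 a b) /\ quat_gens 1 0 a0 b' i' j.
Proof.
have jE : j = mk (qc j 0) (qc j 1) (qc j 2) (qc j 3).
  by apply: quat_eqP; rewrite qcE.
move: (qc j 0) (qc j 1) (qc j 2) (qc j 3) jE => y0 y1 y2 y3 -> b0 -> y23 jj.
suff [t [c [tc A]]] : exists t c, b * (t * y3 + c * y2) = y0 /\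
    a * b * c ^+ 2 = b * t * c.
  exists (a + b * t ^+ 2), (mk 0 1 t 0), (mk 0 1 t c); split.
    have -> : a + b * t ^+ 2 = a + b * t ^+ 2 + b * t * 0 - a * b * 0 ^+ 2.
      by ring.
    by apply: as_slot_gens; [ring | apply: quat_jj].
  have -> : a + b * t ^+ 2 = a + b * t ^+ 2 + b * t * c - a * b * c ^+ 2.
    by rewrite A addrK.
  exact: as_slot_gens.
have [y30|y30] := eqVneq y3 0.
  rewrite y30 eqxx orbF in y23.
  exists (a * (y0 / (b * y2))), (y0 / (b * y2)); rewrite y30.
  split; last by ring.
  by field; rewrite ?y23 ?b0.
exists (y0 / (b * y3)), 0; split; last by ring.
by field; rewrite ?y30 ?b0.
Qed.

(** With i = (x0, 1, x2, x3), the polar form pairs the traceless vector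
(0, 0, p, q) with i to b (x2 q + x3 p). So (0, 0, x2, x3) is orthogonal to i;
when it vanishes, i differs from the standard generator by a scalar and any
vector of the plane will do. *)
Lemma as_common_right (a' : F) (i : T) : b != 0 -> qc i 1 = 1 ->
  i ^+ 2 = i + a'%:A ->
  exists (c : F) (j : T), [/\ j != 0, quat_gens 1 0 a c (qi 1 0 a b) j
    & quat_gens 1 0 a' c i j].
Proof.
have iE : i = mk (qc i 0) (qc i 1) (qc i 2) (qc i 3).
  by apply: quat_eqP; rewrite qcE.
move: (qc i 0) (qc i 1) (qc i 2) (qc i 3) iE => x0 x1 x2 x3 -> b0 -> ii.
have mk0 p q : mk 0 0 p q = 0 -> p = 0 /\ q = 0.
  move=> H; have := qcE 1 0 a b 0 0 p q; rewrite H !qc0.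
  by case=> -[_ <-] <-.
suff [p [q [pq0 pqE]]] : exists p q, mk 0 0 p q != 0 /\ x2 * q = x3 * p.
  exists (b * (p ^+ 2 + p * q - a * q ^+ 2)), (mk 0 0 p q); split=> //.
    exact: as_pure_gens.
  case: (as_pure_gens p q) => _ jj _; split=> //; first by rewrite scale1r.
  rewrite scale0r addr0 scale1r; apply: quat_eqP; rewrite !qcalc.
  - apply: (eq2 (z := b * (x2 * p + x2 * q - a * x3 * q))).
    apply/eqP; rewrite -subr_eq0; apply/eqP.
    transitivity (b * (x3 * p - x2 * q)); first by ring.
    by rewrite pqE subrr mulr0.
  - by ring.
  - by apply: (eq2 (z := x0 * p)); ring.
  - by apply: (eq2 (z := x0 * q)); ring.
have [x20|x20] := eqVneq (mk 0 0 x2 x3) 0; last by exists x2, x3; rewrite mulrC.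
have [-> ->] := mk0 _ _ x20; exists 1, 0; split; last by rewrite !mul0r.
by apply/eqP => /mk0[/eqP]; rewrite oner_eq0.
Qed.

End ArtinSchreier.

Section Bilinear.
Variables a b : F.
Local Notation T := (quat 0 1 a b).
Local Notation mk := (mkquat 0 1 a b).

(** The first hypothesis says that the polar form pairs (0, x, t, 0) with
(y0, y1, y2, 0) to 1. *)
Lemma bi_slot_gens x t y0 y1 y2 b' : t * y1 + x * y2 = 1 ->
  mk y0 y1 y2 0 ^+ 2 = b'%:A ->
  quat_gens 0 1 (a * x ^+ 2 + x * t + b * t ^+ 2) b'
    (mk 0 x t 0) (mk y0 y1 y2 0).
Proof.
move=> txy jj; split=> //.
  by apply: quat_eqP; rewrite expr2 !qcalc; ring.
apply: quat_eqP; rewrite !qcalc.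
- transitivity (t * y1 + x * y2); last by rewrite txy; ring.
  by apply: (eq2 (z := a * x * y1 + b * t * y2)); ring.
- by apply: (eq2 (z := x * y0)); ring.
- by apply: (eq2 (z := t * y0)); ring.
- by ring.
Qed.

(** If y1 <> 0 then 1, j1 and j are independent and one i serves both. If y1 = 0
then j = y0 + y2 j1; the pairing forces x = 1/y2, and t = - a (1 + x) equalises
the squares of (0, 1, t, 0) and (0, x, t, 0). *)
Lemma bi_common_left (b' : F) (j : T) : qc j 3 = 0 ->
  (qc j 1 != 0) || (qc j 2 != 0) -> j ^+ 2 = b'%:A ->
  exists a0 (i i' : T),
    quat_gens 0 1 a0 b i (qj 0 1 a b) /\ quat_gens 0 1 a0 b' i' j.
Proof.
have jE : j = mk (qc j 0) (qc j 1) (qc j 2) (qc j 3).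
  by apply: quat_eqP; rewrite qcE.
move: (qc j 0) (qc j 1) (qc j 2) (qc j 3) jE => y0 y1 y2 y3 -> -> y12 jj.
suff [t [x [tx A]]] : exists t x, t * y1 + x * y2 = 1 /\
    a * x ^+ 2 + x * t = a + t.
  exists (a + t + b * t ^+ 2), (mk 0 1 t 0), (mk 0 x t 0); split.
    have -> : a + t + b * t ^+ 2 = a * 1 ^+ 2 + 1 * t + b * t ^+ 2 by ring.
    by apply: bi_slot_gens; [ring | apply: quat_jj].
  by rewrite -A; apply: bi_slot_gens.
have [y10|y10] := eqVneq y1 0.
  rewrite y10 eqxx /= in y12.
  exists (- a * (1 + y2^-1)), y2^-1; rewrite y10; split; last by ring.
  by field.
exists ((1 - y2) / y1), 1; split; last by ring.
by field.
Qed.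

End Bilinear.

(** * Common slots in a quaternion algebra *)

Section CommonSlots.
Variables (Q : falgType F) (quatQ : quaternion_algebra Q).

(** A nilpotent j makes the plane orthogonal to F(i) hyperbolic, so that this
plane also represents 1. *)
Lemma as_unit_slot (a b : F) (i j0 j : Q) : b != 0 ->
  quat_gens 1 0 a b i j0 -> j != 0 -> quat_gens 1 0 a 0 i j ->
  exists j', quat_gens 1 0 a 1 i j'.
Proof.
move=> b0 gens jn0 gensj.
have [h [hbij hi _]] := quat_iso ch2 quatQ (as_disc b0) gens.
have [h' _ h'K] := hbij; have hinj := bij_inj hbij.
move: gensj jn0; rewrite -hi -(h'K j); set x := h' j => /(quat_gens_inj hinj).
case=> _ xx; rewrite scale1r scale0r addr0 => /as_pureP xE xn0.
have [||p [q pq1]] := @as_isotropic a b (qc x 2) (qc x 3) b0.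
- rewrite -negb_and; apply: contra xn0 => /andP[/eqP x2 /eqP x3].
  rewrite xE x2 x3.
  have -> : mkquat 1 0 a b 0 0 0 0 = 0; last by rewrite raddf0.
  by apply: quat_eqP; rewrite qcE qc0.
- case: (as_pure_gens a b (qc x 2) (qc x 3)) => _; rewrite -xE xx scale0r.
  move/esym/eqP; rewrite scaler_eq0 oner_eq0 orbF mulf_eq0 (negPf b0) /=.
  by move/eqP.
exists (h (mkquat 1 0 a b 0 0 p q)); apply: quat_gens_hom.
by rewrite -[in X in quat_gens _ _ _ X]pq1; apply: as_pure_gens.
Qed.

Lemma as_common_slot_right (a1 a2 b1 b2 : F) (i1 j1 i2 j2 : Q) :
  b1 != 0 -> b2 != 0 ->
  quat_gens 1 0 a1 b1 i1 j1 -> quat_gens 1 0 a2 b2 i2 j2 ->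
  exists b j j',
    [/\ b != 0, quat_gens 1 0 a1 b i1 j & quat_gens 1 0 a2 b i2 j'].
Proof.
move=> b10 b20 gens1 gens2.
have [h [hbij hi _]] := quat_iso ch2 quatQ (as_disc b10) gens1.
have [h' _ h'K] := hbij; have hinj := bij_inj hbij.
have gens2' : quat_gens 1 0 a2 b2 (h' i2) (h' j2).
  by apply: (quat_gens_inj hinj); rewrite !h'K.
have [itr _ _] := quat_gens_trace (as_disc b20) gens2'.
have i21 : qc (h' i2) 1 = 1 by rewrite -[RHS]itr; ring.
have ii : h' i2 ^+ 2 = h' i2 + a2%:A by case: gens2'; rewrite scale1r.
have [c [j [jn0 g1 g2]]] := as_common_right b10 i21 ii.
have {}jn0 : h j != 0 by rewrite -(raddf0 h) (inj_eq hinj).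
have {}g1 : quat_gens 1 0 a1 c i1 (h j) by rewrite -hi; apply: quat_gens_hom.
have {}g2 : quat_gens 1 0 a2 c i2 (h j).
  by rewrite -(h'K i2); apply: quat_gens_hom.
have [c0|c0] := eqVneq c 0; last by exists c, (h j), (h j).
rewrite c0 in g1 g2.
(* The common j is nilpotent: each plane represents 1 by its own vector. *)
have [k1 k1P] := as_unit_slot b10 gens1 jn0 g1.
have [k2 k2P] := as_unit_slot b20 gens2 jn0 g2.
by exists 1, k1, k2; rewrite oner_eq0.
Qed.

Lemma as_common_slot_left (a1 a2 b1 b2 : F) (i1 j1 i2 j2 : Q) :
  b1 != 0 -> b2 != 0 ->
  quat_gens 1 0 a1 b1 i1 j1 -> quat_gens 1 0 a2 b2 i2 j2 ->
  exists a i i', quat_gens 1 0 a b1 i j1 /\ quat_gens 1 0 a b2 i' j2.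
Proof.
move=> b10 b20 gens1 gens2.
have [h [hbij _ hj]] := quat_iso ch2 quatQ (as_disc b10) gens1.
have [h' _ h'K] := hbij; have hinj := bij_inj hbij.
have gens2' : quat_gens 1 0 a2 b2 (h' i2) (h' j2).
  by apply: (quat_gens_inj hinj); rewrite !h'K.
have [_ jtr jnc] := quat_gens_trace (as_disc b20) gens2'.
have j21 : qc (h' j2) 1 = 0 by rewrite -jtr; ring.
rewrite j21 eqxx /= in jnc.
have [_ jj _] := gens2'.
have [a [i [i' [g1 g2]]]] := as_common_left b10 j21 jnc jj.
by exists a, (h i), (h i'); rewrite -hj -(h'K j2); split; apply: quat_gens_hom.
Qed.

Lemma bi_common_slot (a1 a2 b1 b2 : F) (i1 j1 i2 j2 : Q) :
  quat_gens 0 1 a1 b1 i1 j1 -> quat_gens 0 1 a2 b2 i2 j2 ->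
  exists a i i', quat_gens 0 1 a b1 i j1 /\ quat_gens 0 1 a b2 i' j2.
Proof.
move=> gens1 gens2.
have [h [hbij _ hj]] := quat_iso ch2 quatQ (bi_disc _) gens1.
have [h' _ h'K] := hbij; have hinj := bij_inj hbij.
have gens2' : quat_gens 0 1 a2 b2 (h' i2) (h' j2).
  by apply: (quat_gens_inj hinj); rewrite !h'K.
have [_ jtr jnc] := quat_gens_trace (bi_disc _) gens2'.
have j23 : qc (h' j2) 3 = 0 by rewrite -jtr; ring.
rewrite j23 eqxx orbF in jnc.
have [_ jj _] := gens2'.
have [a [i [i' [g1 g2]]]] := bi_common_left j23 jnc jj.
by exists a, (h i), (h i'); rewrite -hj -(h'K j2); split; apply: quat_gens_hom.
Qed.

End CommonSlots.
End Coordinates.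

Theorem theorem2p2 (F : fieldType) (char2 : 2%N \in [pchar F])
    (Q : falgType F) (quatQ : quaternion_algebra Q) :
  [/\ (forall a1 a2 b1 b2 : F, b1 != 0 -> b2 != 0 ->
         brauer_eq Q (quat_as a1 b1) -> brauer_eq Q (quat_as a2 b2) ->
         exists2 b : F, b != 0 &
           brauer_eq Q (quat_as a1 b) /\ brauer_eq Q (quat_as a2 b)),
      (forall a1 a2 b1 b2 : F, b1 != 0 -> b2 != 0 ->
         brauer_eq Q (quat_as a1 b1) -> brauer_eq Q (quat_as a2 b2) ->
         exists a : F,
           brauer_eq Q (quat_as a b1) /\ brauer_eq Q (quat_as a b2))
    & (forall a1 a2 b1 b2 : F,
         brauer_eq Q (quat_bi a1 b1) -> brauer_eq Q (quat_bi a2 b2) ->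
         exists a : F,
           brauer_eq Q (quat_bi a b1) /\ brauer_eq Q (quat_bi a b2))].
Proof.
have asP a b (b0 : b != 0) := brauer_eq_quatP char2 quatQ a (as_disc b0).
have biP a b := brauer_eq_quatP char2 quatQ a (bi_disc b).
split=> a1 a2 b1 b2.
- move=> b10 b20 /(asP _ _ b10)[i1 [j1 g1]] /(asP _ _ b20)[i2 [j2 g2]].
  have [b [j [j' [b0 g g']]]] := as_common_slot_right char2 quatQ b10 b20 g1 g2.
  by exists b => //; split; apply/(asP _ _ b0); [exists i1, j | exists i2, j'].
- move=> b10 b20 /(asP _ _ b10)[i1 [j1 g1]] /(asP _ _ b20)[i2 [j2 g2]].
  have [a [i [i' [g g']]]] := as_common_slot_left char2 quatQ b10 b20 g1 g2.
  exists a; split; first by apply/(asP _ _ b10); exists i, j1.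
  by apply/(asP _ _ b20); exists i', j2.
move=> /biP[i1 [j1 g1]] /biP[i2 [j2 g2]].
have [a [i [i' [g g']]]] := bi_common_slot char2 quatQ g1 g2.
by exists a; split; apply/biP; [exists i, j1 | exists i', j2].
Qed.
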